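(* Let $S$ be a BF-domain. Then each of the following rings is a BF-domain: (1) the skew polynomial ring $S[x;\sigma,\delta]$, where $\sigma$ is an injective ring endomorphism of $S$ such that $\sigma(a)\in S^\times$ implies $a\in S^\times$ for all $a\in S$, and $\delta$ is a $\sigma$-derivation of $S$; (2) the skew Laurent polynomial ring $S[x^{\pm1};\sigma]$, where $\sigma$ is a ring automorphism of $S$.
   Context: Rings are associative with identity; domains need not be commutative. Convention: elements of $S[x;\sigma,\delta]$ are uniquely written as $\sum_{i=0}^n x^ia_i$ with $a_i\in S$, with multiplication determined by $ax=x\sigma(a)+\delta(a)$ for $a\in S$, where a $\sigma$-derivation $\delta$ is an additive map $S\to S$ with $\delta(ab)=a\delta(b)+\delta(a)\sigma(b)$. Elements of $S[x^{\pm1};\sigma]$ are uniquely written as $\sum_{i=m}^n x^ia_i$ with $m\le n$ integers, with $ax=x\sigma(a)$. $R^\times$ is the group of units of a ring $R$, and $R^\bullet$ is the multiplicative monoid of cancellative elements (neither left nor right zero-divisors). A nonunit $u\in R^\bullet$ is an atom if $u=ab$ with $a,b\in R^\bullet$ implies that $a$ or $b$ is a unit. $R$ is a BF-ring if every nonunit of $R^\bullet$ is a finite product of atoms of $R^\bullet$ and for every $a\in R^\bullet$ there is $\lambda(a)\in\mathbb{Z}_{\ge 0}$ such that $k\le\lambda(a)$ whenever $a=u_1\cdots u_k$ with atoms $u_i$ of $R^\bullet$. A BF-domain is a domain that is a BF-ring. *)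

(* Defs.v *)
From HB Require Import structures.
From mathcomp Require Import all_boot all_order all_algebra.
From mathcomp Require Import finmap.
From mathcomp Require Export monalg.

Set Implicit Arguments.
Unset Strict Implicit.
Unset Printing Implicit Defensive.

Import GRing.Theory.
Local Open Scope ring_scope.

Section Factorization.
Variable R : nzRingType.
Implicit Types a b u : R.

(* [GRing.unit] needs a [unitRingType], i.e. a decidable unit predicate. *)
Definition ring_unit a : Prop := exists b, a * b = 1 /\ b * a = 1.

Definition cancellative a : Prop := GRing.lreg a /\ GRing.rreg a.

Definition atom u : Prop :=
  [/\ cancellative u, ~ ring_unit u &
      forall a b, cancellative a -> cancellative b -> u = a * b ->
        ring_unit a \/ ring_unit b].

Definition BF_ring : Prop :=
  (forall a, cancellative a -> ~ ring_unit a ->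
     exists us : seq R, {in us, forall u, atom u} /\ a = \prod_(u <- us) u) /\
  (forall a, cancellative a ->
     exists lambda : nat, forall us : seq R,
       {in us, forall u, atom u} -> a = \prod_(u <- us) u ->
       (size us <= lambda)%N).

Definition noncomm_domain : Prop :=
  forall a b, a * b = 0 -> a = 0 \/ b = 0.

Definition BF_domain : Prop := noncomm_domain /\ BF_ring.

End Factorization.

Definition sigma_derivation (S : nzRingType) (sigma : {rmorphism S -> S})
    (delta : {additive S -> S}) : Prop :=
  forall a b, delta (a * b) = a * delta b + delta a * sigma b.

(* R is S[x; sigma, delta], S being embedded in R by iota.  Unique expansion
   is over {poly S}, used only as the type of finitely supported coefficient
   sequences nat -> S. *)
Record is_skew_poly_ring (S : nzRingType) (sigma : {rmorphism S -> S})
    (delta : {additive S -> S}) (R : nzRingType) (iota : {rmorphism S -> R})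
    (x : R) : Prop := {
  skew_poly_comm : forall a : S,
    iota a * x = x * iota (sigma a) + iota (delta a);
  skew_poly_expansion : forall r : R, exists! p : {poly S},
    r = \sum_(i < size p) x ^+ i * iota p`_i }.

(* x ^ k for k : int, where y is the inverse of x. *)
Definition zexp (R : nzRingType) (x y : R) (k : int) : R :=
  match k with Posz n => x ^+ n | Negz n => y ^+ n.+1 end.

(* R is S[x^{+-1}; sigma], with y = x^{-1}.  {malg S[int]} is used only as the
   type of finitely supported functions int -> S. *)
Record is_skew_Laurent_ring (S : nzRingType) (sigma : {rmorphism S -> S})
    (R : nzRingType) (iota : {rmorphism S -> R}) (x y : R) : Prop := {
  skew_Laurent_xy : x * y = 1;
  skew_Laurent_yx : y * x = 1;
  skew_Laurent_comm : forall a : S, iota a * x = x * iota (sigma a);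
  skew_Laurent_expansion : forall r : R, exists! c : {malg S[int]},
    r = \sum_(k <- msupp c) zexp x y k * iota c@_k }.

(* Explicit models, showing that both kinds of rings exist. *)

Section SkewPolyModel.
Variables (S : nzRingType) (sigma : {rmorphism S -> S}).
Variable delta : {additive S -> S}.
Hypothesis deltaP : sigma_derivation sigma delta.
Implicit Types (p q r : {poly S}) (a b : S).

(* Right multiplication by x: f x = x sigma(f) + delta(f), coefficientwise. *)
Definition skew_mulX p := 'X * map_poly sigma p + map_poly delta p.

Lemma skew_mulX_is_additive : zmod_morphism skew_mulX.
Proof.
move=> p q; rewrite /skew_mulX !raddfB /= mulrBr.
by rewrite opprD addrACA.
Qed.
HB.instance Definition _ :=
  GRing.isZmodMorphism.Build {poly S} {poly S} skew_mulX skew_mulX_is_additive.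

Lemma iter_skewB j p q :
  iter j skew_mulX (p - q) = iter j skew_mulX p - iter j skew_mulX q.
Proof. by elim: j => //= j ->; rewrite raddfB. Qed.

Lemma iter_skew0 j : iter j skew_mulX 0 = 0.
Proof. by rewrite -(subrr 0) iter_skewB !subrr. Qed.

Lemma iter_skewD j p q :
  iter j skew_mulX (p + q) = iter j skew_mulX p + iter j skew_mulX q.
Proof. by elim: j => //= j ->; rewrite raddfD. Qed.

Definition skew_mul p q : {poly S} :=
  \sum_(j < size q) iter j skew_mulX p * (q`_j)%:P.

Lemma skew_mulE n p q : (size q <= n)%N ->
  skew_mul p q = \sum_(j < n) iter j skew_mulX p * (q`_j)%:P.
Proof.
move=> le_q_n; rewrite /skew_mul.
rewrite (big_ord_widen _ (fun j => iter j skew_mulX p * (q`_j)%:P) le_q_n).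
rewrite [RHS](bigID (fun j : 'I_n => (j < size q)%N)) /= [X in _ + X]big1 ?addr0 //.
by move=> j; rewrite -leqNgt => ?; rewrite nth_default // mulr0.
Qed.

Lemma skew_mulDl : left_distributive skew_mul +%R.
Proof.
move=> p q r; rewrite /skew_mul -big_split /=; apply: eq_bigr => j _.
by rewrite iter_skewD mulrDl.
Qed.

Lemma skew_mulDr : right_distributive skew_mul +%R.
Proof.
move=> p q r; pose n := maxn (size q) (size r).
rewrite !(@skew_mulE n) ?leq_maxl ?leq_maxr ?size_polyD //.
rewrite -big_split /=; apply: eq_bigr => j _.
by rewrite coefD polyCD mulrDr.
Qed.

Lemma skew_mulp0 p : skew_mul p 0 = 0.
Proof. by rewrite /skew_mul size_poly0 big_ord0. Qed.

Lemma skew_mul0p p : skew_mul 0 p = 0.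
Proof. by rewrite /skew_mul big1 // => j _; rewrite iter_skew0 mul0r. Qed.

Lemma skew_mulXnC p j b :
  skew_mul p ('X^j * b%:P) = iter j skew_mulX p * b%:P.
Proof.
rewrite (@skew_mulE j.+1).
  rewrite big_ord_recr /= big1 ?add0r => [|i _]; last first.
    by rewrite coefMC coefXn (ltn_eqF (ltn_ord i)) mul0r mulr0.
  by rewrite coefMC coefXn eqxx mul1r.
apply/leq_sizeP => i lt_j_i.
by rewrite coefMC coefXn gtn_eqF // mul0r.
Qed.

Lemma skew_poly_ind (P : {poly S} -> Prop) :
  P 0 -> (forall p q, P p -> P q -> P (p + q)) ->
  (forall j b, P ('X^j * b%:P)) -> forall p, P p.
Proof.
move=> P0 PD PX p; rewrite -[p]coefK poly_def.
apply: big_ind => // i _.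
have -> : p`_i *: 'X^i = 'X^i * (p`_i)%:P :> {poly S} by rewrite -mul_polyC commr_polyXn.
exact: PX.
Qed.

Lemma skew_mulX_C p b :
  skew_mulX (p * b%:P) = skew_mulX p * (sigma b)%:P + p * (delta b)%:P.
Proof.
rewrite /skew_mulX rmorphM /= map_polyC /= mulrDl mulrA -addrA.
congr (_ + _); rewrite addrC.
apply/polyP => i; rewrite coef_map_id0 ?raddf0 // coefD !coefMC.
by rewrite coef_map_id0 ?raddf0 // deltaP.
Qed.

Lemma skew_mulX_Xn j : skew_mulX 'X^j = ('X^(j.+1) : {poly S}).
Proof.
have d1 : delta 1 = 0.
  have := deltaP 1 1; rewrite rmorph1 !mulr1 mul1r => /eqP.
  by rewrite -subr_eq subrr eq_sym => /eqP.
rewrite /skew_mulX rmorphXn /= map_polyX -exprS.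
rewrite [map_poly _ _](_ : _ = 0) ?addr0 //; apply/polyP => i.
by rewrite coef_map_id0 ?raddf0 // coefXn coef0; case: eqP; rewrite ?raddf0.
Qed.

Lemma skew_mulXr p q : skew_mulX (skew_mul p q) = skew_mul p (skew_mulX q).
Proof.
elim/skew_poly_ind: q => [|q1 q2 IH1 IH2|j b].
- by rewrite raddf0 !skew_mulp0 raddf0.
- by rewrite skew_mulDr !raddfD /= skew_mulDr IH1 IH2.
rewrite skew_mulXnC !skew_mulX_C skew_mulDr.
by rewrite skew_mulX_Xn !skew_mulXnC.
Qed.

Lemma skew_mulC p q b : skew_mul p (q * b%:P) = skew_mul p q * b%:P.
Proof.
elim/skew_poly_ind: q => [|q1 q2 IH1 IH2|j c].
- by rewrite mul0r skew_mulp0 mul0r.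
- by rewrite mulrDl !skew_mulDr mulrDl IH1 IH2.
by rewrite -mulrA -polyCM !skew_mulXnC polyCM mulrA.
Qed.

Lemma skew_mulA : associative skew_mul.
Proof.
move=> p q r; elim/skew_poly_ind: r => [|r1 r2 IH1 IH2|j c].
- by rewrite !skew_mulp0.
- by rewrite !skew_mulDr IH1 IH2.
rewrite !skew_mulXnC skew_mulC; congr (_ * _).
by elim: j => //= j <-; rewrite skew_mulXr.
Qed.

Lemma skew_mulp1 : right_id 1 skew_mul.
Proof. by move=> p; have := skew_mulXnC p 0 1; rewrite expr0 !mulr1. Qed.

Lemma iter_skew1 j : iter j skew_mulX 1 = 'X^j.
Proof. by elim: j => //= j ->; rewrite skew_mulX_Xn. Qed.

Lemma skew_mul1p : left_id 1 skew_mul.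
Proof.
elim/skew_poly_ind => [|q1 q2 IH1 IH2|j c]; first exact: skew_mulp0.
  by rewrite skew_mulDr IH1 IH2.
by rewrite skew_mulXnC iter_skew1.
Qed.

Definition skew_poly of sigma_derivation sigma delta : Type := {poly S}.
Local Notation T := (skew_poly deltaP).

HB.instance Definition _ := GRing.Zmodule.on T.
HB.instance Definition _ := GRing.Zmodule_isNzRing.Build T
  skew_mulA skew_mul1p skew_mulp1 skew_mulDl skew_mulDr (oner_neq0 {poly S}).

Definition skew_polyC (a : S) : T := a%:P.

Lemma skew_polyC_is_additive : zmod_morphism skew_polyC.
Proof. by move=> a b; rewrite /skew_polyC polyCB. Qed.

Lemma skew_polyC_is_multiplicative : monoid_morphism skew_polyC.
Proof.
split=> // a b; apply: esym; have := skew_mulXnC a%:P 0 b.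
by rewrite expr0 mul1r /= -polyCM.
Qed.

HB.instance Definition _ :=
  GRing.isZmodMorphism.Build S T skew_polyC skew_polyC_is_additive.
HB.instance Definition _ :=
  GRing.isMonoidMorphism.Build S T skew_polyC skew_polyC_is_multiplicative.

Definition skew_polyX : T := 'X : {poly S}.

Lemma skew_poly_mulX (p : T) : p * skew_polyX = skew_mulX p.
Proof. by have := skew_mulXnC p 1 1; rewrite !mulr1. Qed.

Lemma skew_polyXn i : skew_polyX ^+ i = 'X^i :> {poly S}.
Proof.
elim: i => // i IH; rewrite exprSr skew_poly_mulX IH.
exact: skew_mulX_Xn.
Qed.

Lemma skew_poly_expand (p : {poly S}) :
  (p : T) = \sum_(i < size p) skew_polyX ^+ i * skew_polyC p`_i.
Proof.
rewrite -[LHS]coefK poly_def; apply: eq_bigr => i _.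
have -> : skew_polyX ^+ i * skew_polyC p`_i = ('X^i : {poly S}) * (p`_i)%:P.
  by rewrite skew_polyXn; have := skew_mulXnC 'X^i 0 p`_i; rewrite mul1r.
by rewrite -mul_polyC commr_polyXn.
Qed.

Theorem skew_polyP : is_skew_poly_ring sigma delta skew_polyC skew_polyX.
Proof.
split=> [a|r]; last first.
  exists r; split=> [|q ->]; first exact: skew_poly_expand.
  by rewrite -skew_poly_expand.
have -> : skew_polyX * skew_polyC (sigma a) = ('X : {poly S}) * (sigma a)%:P.
  by have := skew_mulXnC 'X 0 (sigma a); rewrite mul1r.
rewrite skew_poly_mulX /skew_mulX /skew_polyC map_polyC /=.
by congr (_ + _); apply/polyP => i; rewrite coef_map_id0 ?raddf0 // !coefC; case: eqP; rewrite ?raddf0.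
Qed.

End SkewPolyModel.

Section SkewLaurentModel.
Variables (S : nzRingType) (sigma : {rmorphism S -> S}) (tau : S -> S).
Hypotheses (sigmaK : cancel sigma tau) (tauK : cancel tau sigma).
Implicit Types (a b : S) (k l : int) (f g h : {malg S[int]}).

(* sigma ^ k for k : int *)
Definition zsigma k : S -> S :=
  match k with Posz n => iter n sigma | Negz n => iter n.+1 tau end.

Lemma zsigmaS k a : zsigma (k + 1) a = sigma (zsigma k a).
Proof.
case: k => [n|[|n]]; first by rewrite -PoszD addn1.
  by rewrite /= tauK.
have -> : Negz n.+1 + 1 = Negz n by rewrite !NegzE -[n.+2]addn1 PoszD opprD addrNK.
by rewrite /= tauK.
Qed.

Lemma zsigmaP k a : zsigma (k - 1) a = tau (zsigma k a).
Proof. by rewrite -[k in RHS](subrK 1) zsigmaS sigmaK. Qed.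

Lemma zsigmaD k l a : zsigma (k + l) a = zsigma k (zsigma l a).
Proof.
elim/int_rect: k => [|n IH|n IH]; first by rewrite add0r.
  by rewrite -addn1 PoszD addrAC !zsigmaS IH.
by rewrite -addn1 PoszD opprD addrAC !zsigmaP IH.
Qed.

Lemma zsigmaB k a b : zsigma k (a - b) = zsigma k a - zsigma k b.
Proof.
have tauB u v : tau (u - v) = tau u - tau v.
  by apply: (can_inj sigmaK); rewrite rmorphB /= !tauK.
elim/int_rect: k => // n IH; first by rewrite -addn1 PoszD !zsigmaS IH rmorphB.
by rewrite -addn1 PoszD opprD !zsigmaP IH tauB.
Qed.

Lemma zsigmaM k a b : zsigma k (a * b) = zsigma k a * zsigma k b.
Proof.
have tauM u v : tau (u * v) = tau u * tau v.
  by apply: (can_inj sigmaK); rewrite rmorphM /= !tauK.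
elim/int_rect: k => // n IH; first by rewrite -addn1 PoszD !zsigmaS IH rmorphM.
by rewrite -addn1 PoszD opprD !zsigmaP IH tauM.
Qed.

Lemma zsigma1 k : zsigma k 1 = 1.
Proof.
have tau1 : tau 1 = 1 by rewrite -{1}(rmorph1 sigma) sigmaK.
elim/int_rect: k => [|n IH|n IH] //; first by rewrite -addn1 PoszD zsigmaS IH rmorph1.
by rewrite -addn1 PoszD opprD zsigmaP IH tau1.
Qed.

Section Lift.
Variables (A : zmodType) (F : int -> S -> A).
Hypothesis FB : forall k, zmod_morphism (F k).

Definition malg_lift g : A := \sum_(k <- msupp g) F k g@_k.

Lemma malg_lift_F0 k : F k 0 = 0.
Proof. by have := FB k 0 0; rewrite subr0 subrr. Qed.

Lemma malg_liftE (D : {fset int}) g : (msupp g `<=` D)%fset ->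
  malg_lift g = \sum_(k <- D) F k g@_k.
Proof.
move=> sgD; apply: big_fset_incl => // k _ /mcoeff_outdom ->.
exact: malg_lift_F0.
Qed.

Lemma malg_liftB : zmod_morphism malg_lift.
Proof.
move=> f g; pose D := (msupp f `|` msupp g)%fset.
rewrite !(@malg_liftE D) ?fsubsetUl ?fsubsetUr ?msuppB_le // -sumrB.
by apply: eq_bigr => k _; rewrite mcoeffB FB.
Qed.

Lemma malg_liftU a k : malg_lift << a *g k >> = F k a.
Proof.
by rewrite (@malg_liftE [fset k]%fset) ?msuppU_le // big_seq_fset1 mcoeffUU.
Qed.

End Lift.

Lemma malg_ind (P : {malg S[int]} -> Prop) :
  P 0 -> (forall f g, P f -> P g -> P (f + g)) ->
  (forall a k, P << a *g k >>) -> forall f, P f.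
Proof. by move=> P0 PD PU f; rewrite [f]monalgE; apply: big_ind. Qed.

Definition laurent_mul f g : {malg S[int]} :=
  malg_lift (fun l b => malg_lift (fun k a => << zsigma l a * b *g k + l >>) f) g.

Lemma laurent_mul_inB l b :
  zmod_morphism (malg_lift (fun k a => << zsigma l a * b *g k + l >>)).
Proof. by apply: malg_liftB => k a a'; rewrite zsigmaB mulrBl monalgUB. Qed.

Lemma laurent_mul_outB f l :
  zmod_morphism (fun b => malg_lift (fun k a => << zsigma l a * b *g k + l >>) f).
Proof.
move=> b b'; rewrite /malg_lift -sumrB; apply: eq_bigr => k _.
by rewrite mulrBr monalgUB.
Qed.

Lemma laurent_mulBr f : zmod_morphism (laurent_mul f).
Proof. exact/malg_liftB/laurent_mul_outB. Qed.

Lemma laurent_mulBl g : zmod_morphism (laurent_mul^~ g).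
Proof.
move=> f f'; rewrite /laurent_mul {1 3 5}/malg_lift -sumrB.
by apply: eq_bigr => k _; rewrite laurent_mul_inB.
Qed.

Lemma laurent_mul0r f : laurent_mul f 0 = 0.
Proof. by have := laurent_mulBr f 0 0; rewrite subr0 subrr. Qed.

Lemma laurent_mulDr : right_distributive laurent_mul +%R.
Proof.
move=> f g h; have N u : laurent_mul f (- u) = - laurent_mul f u.
  by rewrite -sub0r laurent_mulBr laurent_mul0r sub0r.
by rewrite -{1}[h]opprK laurent_mulBr N opprK.
Qed.

Lemma laurent_mul0l f : laurent_mul 0 f = 0.
Proof. by have := laurent_mulBl f 0 0; rewrite subr0 subrr. Qed.

Lemma laurent_mulDl : left_distributive laurent_mul +%R.
Proof.
move=> f g h; have N u : laurent_mul (- u) h = - laurent_mul u h.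
  by rewrite -sub0r laurent_mulBl laurent_mul0l sub0r.
by rewrite -{1}[g]opprK laurent_mulBl N opprK.
Qed.

Lemma laurent_mulUU a b k l :
  laurent_mul << a *g k >> << b *g l >> = << zsigma l a * b *g k + l >>.
Proof.
rewrite /laurent_mul malg_liftU; last exact: laurent_mul_outB.
by rewrite malg_liftU // => k' a1 a2; rewrite zsigmaB mulrBl monalgUB.
Qed.

Lemma laurent_mulA : associative laurent_mul.
Proof.
move=> f g h; elim/malg_ind: h => [|h1 h2 IH1 IH2|c m].
- by rewrite !laurent_mul0r.
- by rewrite !laurent_mulDr IH1 IH2.
elim/malg_ind: g => [|h1 h2 IH1 IH2|b l].
- by rewrite laurent_mul0l !laurent_mul0r laurent_mul0l.
- by rewrite laurent_mulDr !laurent_mulDl laurent_mulDr IH1 IH2.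
elim/malg_ind: f => [|h1 h2 IH1 IH2|a k].
- by rewrite !laurent_mul0l.
- by rewrite !laurent_mulDl IH1 IH2.
by rewrite !laurent_mulUU zsigmaM mulrA addrA addrC [l + m]addrC zsigmaD.
Qed.

Lemma laurent_mul1l : left_id << 1 *g 0 >> laurent_mul.
Proof.
elim/malg_ind => [|h1 h2 IH1 IH2|a k]; first by rewrite laurent_mul0r.
  by rewrite laurent_mulDr IH1 IH2.
by rewrite laurent_mulUU zsigma1 mul1r add0r.
Qed.

Lemma laurent_mul1r : right_id << 1 *g 0 >> laurent_mul.
Proof.
elim/malg_ind => [|h1 h2 IH1 IH2|a k]; first by rewrite laurent_mul0l.
  by rewrite laurent_mulDl IH1 IH2.
by rewrite laurent_mulUU /= mulr1 addr0.
Qed.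

Lemma laurent_1_neq0 : << 1 *g 0 >> != 0 :> {malg S[int]}.
Proof. by rewrite monalgU_eq0 oner_neq0. Qed.

Definition skew_Laurent of cancel sigma tau & cancel tau sigma : Type :=
  {malg S[int]}.
Local Notation T := (skew_Laurent sigmaK tauK).

HB.instance Definition _ := GRing.Zmodule.on T.
HB.instance Definition _ := GRing.Zmodule_isNzRing.Build T
  laurent_mulA laurent_mul1l laurent_mul1r laurent_mulDl laurent_mulDr
  laurent_1_neq0.

Definition skew_LaurentC (a : S) : T := << a *g 0 >>.

Lemma skew_LaurentC_is_additive : zmod_morphism skew_LaurentC.
Proof. by move=> a b; rewrite /skew_LaurentC monalgUB. Qed.

Lemma skew_LaurentC_is_multiplicative : monoid_morphism skew_LaurentC.
Proof. by split=> // a b; apply: esym; apply: laurent_mulUU. Qed.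

HB.instance Definition _ :=
  GRing.isZmodMorphism.Build S T skew_LaurentC skew_LaurentC_is_additive.
HB.instance Definition _ :=
  GRing.isMonoidMorphism.Build S T skew_LaurentC skew_LaurentC_is_multiplicative.

Definition skew_LaurentX : T := (<< 1 *g 1 >> : {malg S[int]}).
Definition skew_LaurentV : T := (<< 1 *g -1 >> : {malg S[int]}).

Lemma skew_LaurentXn k :
  zexp skew_LaurentX skew_LaurentV k = (<< 1 *g k >> : {malg S[int]}).
Proof.
case: k => n /=.
  elim: n => // n IH; rewrite exprSr IH.
  by rewrite [LHS]laurent_mulUU zsigma1 mulr1 -PoszD addn1.
elim: n => // n IH; rewrite exprSr IH.
by rewrite [LHS]laurent_mulUU zsigma1 mulr1 !NegzE -opprD -PoszD addn1.
Qed.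

Lemma skew_Laurent_expand f : (f : T) =
  \sum_(k <- msupp f) zexp skew_LaurentX skew_LaurentV k * skew_LaurentC f@_k.
Proof.
rewrite [LHS]monalgE; apply: eq_bigr => k _; rewrite skew_LaurentXn.
by apply: esym; rewrite [LHS]laurent_mulUU mul1r addr0.
Qed.

Theorem skew_LaurentP :
  is_skew_Laurent_ring sigma skew_LaurentC skew_LaurentX skew_LaurentV.
Proof.
split=> [||a|r].
- by rewrite [LHS]laurent_mulUU zsigma1 mulr1.
- by rewrite [LHS]laurent_mulUU zsigma1 mulr1.
- by rewrite [LHS]laurent_mulUU [RHS]laurent_mulUU mulr1 mul1r addr0 add0r.
- exists r; split=> [|q ->]; first exact: skew_Laurent_expand.
  by rewrite -skew_Laurent_expand.
Qed.

End SkewLaurentModel.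

(* Main.v *)
Require Import Defs.
From HB Require Import structures.
From mathcomp Require Import all_boot all_order all_algebra.
From mathcomp Require Import finmap boolp zify.

Set Implicit Arguments.
Unset Strict Implicit.
Unset Printing Implicit Defensive.

Import GRing.Theory.
Local Open Scope ring_scope.

(** A domain is a BF-domain as soon as its nonzero elements carry a
    superadditive weight in the natural numbers whose value 0 is taken on units
    only: every nonunit then has positive weight, so splitting an element into
    nonunits must stop, and no factorization of a has more atoms than the weight
    of a ([BF_domain_of_weight]).

    Conversely a BF-domain S carries such a weight, namely the largest k such that
    the element is a product of k nonunits and one further factor ([splits_bounded],
    [splitting_lengthM]).  This one has the extra property that it does not
    decrease under a multiplicative map f for which f b is a unit only if b is
    one: the image of a splitting is again a splitting
    ([splitting_length_morph]).  That is where the hypothesis on sigma enters.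

    For S[x; sigma, delta] one weighs f by deg f + lam (lc f), with lam the
    weight on S and lc the leading coefficient.  Since a x = x sigma(a) + ..., the
    degree of f g is deg f + deg g and
    lc (f g) = sigma^(deg g) (lc f) * lc g, whence superadditivity
    ([poly_weight_skew_mul]).  Weight 0 means a constant c with lam c = 0, that
    is, a unit of S.

    In S[x^-1, x; sigma] every nonzero element is, up to powers of the unit x on
    the left, a unique skew polynomial with nonzero constant coefficient; its
    weight is the weight of that polynomial.  Moving powers of x through a
    product twists coefficients by powers of sigma and of its inverse, which
    does not decrease weights, and with delta = 0 constant coefficients multiply, so the
    product of two normal forms is again a normal form. *)

(** * Units and factors in a domain *)

Section Units.
Variable R : nzRingType.
Implicit Types a b u : R.

Lemma ring_unit1 : ring_unit (1 : R).
Proof. by exists 1; rewrite mulr1. Qed.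

Lemma ring_unitM a b : ring_unit a -> ring_unit b -> ring_unit (a * b).
Proof.
move=> [a' [aa' a'a]] [b' [bb' b'b]]; exists (b' * a').
by rewrite mulrA -(mulrA a) bb' mulr1 aa' mulrA -(mulrA b') a'a mulr1 b'b.
Qed.

Lemma ring_unitMl a b : ring_unit a -> ring_unit (a * b) -> ring_unit b.
Proof.
move=> [a' [aa' a'a]] ab_unit; rewrite -[b]mul1r -a'a -mulrA.
by apply: ring_unitM => //; exists a.
Qed.

Lemma ring_unitX a n : ring_unit a -> ring_unit (a ^+ n).
Proof.
move=> ua; elim: n => [|n IH]; first by rewrite expr0; exact: ring_unit1.
by rewrite exprS; apply: ring_unitM.
Qed.

Lemma ring_unit_cancel (f g : R -> R) a : cancel f g ->
  {morph g : b c / b * c} -> g 1 = 1 -> ring_unit (f a) -> ring_unit a.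
Proof.
by move=> fK gM g1 [b [ab ba]]; exists (g b); rewrite -[a]fK -!gM ab ba g1.
Qed.

Lemma cancellative_neq0 a : cancellative a -> a != 0.
Proof. by move=> [ra _]; apply: lreg_neq0. Qed.

Hypothesis dom : noncomm_domain R.

Lemma domain_mul_neq0 a b : a != 0 -> b != 0 -> a * b != 0.
Proof.
by move=> /eqP a0 /eqP b0; apply/eqP => /dom[].
Qed.

Lemma domain_cancellative a : a != 0 -> cancellative a.
Proof.
move=> /eqP a0; split=> b c /eqP; rewrite -subr_eq0.
  by rewrite -mulrBr => /eqP/dom[//|/eqP]; rewrite subr_eq0 => /eqP.
by rewrite -mulrBl => /eqP/dom[/eqP|//]; rewrite subr_eq0 => /eqP.
Qed.

Lemma domain_ring_unit a b : a * b = 1 -> ring_unit a.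
Proof.
move=> ab1; exists b; split=> //.
have a_neq0 : a != 0.
  by apply/eqP => a0; move/eqP: ab1; rewrite a0 mul0r eq_sym oner_eq0.
have [lreg_a _] := domain_cancellative a_neq0.
by apply: lreg_a; rewrite mulrA ab1 mul1r mulr1.
Qed.

(** In a domain one-sided inverses are two-sided, so the units are closed under
    taking factors. *)
Lemma domain_ring_unit_factor a b :
  ring_unit (a * b) -> ring_unit a /\ ring_unit b.
Proof.
move=> ab_unit; have [c [abc _]] := ab_unit.
have ua : ring_unit a by apply: (@domain_ring_unit _ (b * c)); rewrite mulrA.
by split=> //; apply: ring_unitMl ab_unit.
Qed.

Lemma cat_atoms (us vs : seq R) :
  {in us, forall u, atom u} -> {in vs, forall u, atom u} ->
  {in us ++ vs, forall u, atom u}.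
Proof. by move=> Hu Hv u; rewrite mem_cat => /orP[/Hu|/Hv]. Qed.

End Units.

(** * A weight bounds factorizations *)

Section Criterion.
(** The weight is a functional relation, total on nonzero elements, so that it
    can be read off a normal form without choosing one. *)
Variables (R : nzRingType) (w : R -> nat -> Prop).
Hypothesis w_ex : forall r, r != 0 -> exists n, w r n.
Hypothesis w_neq0 : forall r n, w r n -> r != 0.
Hypothesis w_fun : forall r n m, w r n -> w r m -> n = m.
Hypothesis w_mul : forall r s n m, w r n -> w s m ->
  exists2 l, w (r * s) l & (n + m <= l)%N.
Hypothesis w_unit : forall r, w r 0 -> ring_unit r.

Lemma weight_domain : noncomm_domain R.
Proof.
move=> a b ab0; have [->|a0] := eqVneq a 0; first by left.
have [->|b0] := eqVneq b 0; first by right.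
have [n wa] := w_ex a0; have [m wb] := w_ex b0.
by have [l /w_neq0] := w_mul wa wb; rewrite ab0 eqxx.
Qed.

Lemma weight_gt0 r n : ~ ring_unit r -> w r n -> (0 < n)%N.
Proof. by case: n => // r_nonunit /w_unit. Qed.

Lemma weight_atoms (us : seq R) : {in us, forall u, atom u} ->
  exists2 n, w (\prod_(u <- us) u) n & (size us <= n)%N.
Proof.
elim: us => [_|u us IH atoms].
  by rewrite big_nil; have [n wn] := w_ex (oner_neq0 R); exists n.
have [|m wm le_m] := IH.
  by move=> v v_us; apply: atoms; rewrite in_cons v_us orbT.
have [/cancellative_neq0/w_ex[n wn] u_nonunit _] := atoms u (mem_head _ _).
have n_gt0 := weight_gt0 u_nonunit wn.
have [l wl le_l] := w_mul wn wm; exists l; first by rewrite big_cons.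
by rewrite /=; lia.
Qed.

(** Strong induction on the weight: a nonunit that is not an atom is a product of
    two nonunits, both of smaller weight since each has positive weight. *)
Lemma weight_factorization a : a != 0 -> ~ ring_unit a ->
  exists us : seq R, {in us, forall u, atom u} /\ a = \prod_(u <- us) u.
Proof.
move=> /w_ex[n]; have [N] := ubnP n; elim: N => // N IH in n a *.
move=> lt_n wa a_nonunit; have dom := weight_domain.
have [atom_a|not_atom] := pselect (atom a).
  exists [:: a]; split=> [u|]; last by rewrite big_seq1.
  by rewrite inE => /eqP ->.
have [b [c [cb [cc [abc [b_nonunit c_nonunit]]]]]] :
    exists b c, cancellative b /\ cancellative c /\ a = b * c /\
      ~ ring_unit b /\ ~ ring_unit c.
  apply: contrapT => no_split; apply: not_atom; split=> //.
    exact: domain_cancellative (w_neq0 wa).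
  move=> b c cb cc abc; have [ub|b_nonunit] := pselect (ring_unit b).
    by left.
  right; apply: contrapT => c_nonunit; apply: no_split.
  by exists b, c.
have [k wb] := w_ex (cancellative_neq0 cb).
have [m wc] := w_ex (cancellative_neq0 cc).
have [l] := w_mul wb wc; rewrite -abc => /(w_fun wa) <- le_n.
have k_gt0 := weight_gt0 b_nonunit wb; have m_gt0 := weight_gt0 c_nonunit wc.
have [us [atoms_us b_us]] : exists us : seq R,
    {in us, forall u, atom u} /\ b = \prod_(u <- us) u.
  by apply: IH wb b_nonunit; lia.
have [vs [atoms_vs c_vs]] : exists vs : seq R,
    {in vs, forall u, atom u} /\ c = \prod_(u <- vs) u.
  by apply: IH wc c_nonunit; lia.
exists (us ++ vs); rewrite big_cat -b_us -c_vs; split=> //.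
exact: cat_atoms.
Qed.

Lemma BF_domain_of_weight : BF_domain R.
Proof.
split; first exact: weight_domain.
split=> a /cancellative_neq0 a0; first exact: weight_factorization.
have [n wa] := w_ex a0; exists n => us /weight_atoms[m wm le_m] a_us.
by rewrite (w_fun wa (m := m)) // a_us.
Qed.

End Criterion.

(** * The splitting length of a BF-domain *)

(** The last cofactor is arbitrary, possibly a unit.  This makes the notion stable
    under multiplication by any element, whereas a unit other than 1 is not a
    product of nonunits at all. *)
Fixpoint splits (S : nzRingType) (k : nat) (a : S) : Prop :=
  if k is k'.+1
  then exists b c, [/\ ~ ring_unit b, splits k' c & a = b * c] else True.

Lemma splits_morph (S : nzRingType) (f : S -> S) k (a : S) :
  {morph f : b c / b * c} -> (forall b, ring_unit (f b) -> ring_unit b) ->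
  splits k a -> splits k (f a).
Proof.
move=> fM f_unit; elim: k a => //= k IH a [b [c [b_nonunit c_k ->]]].
by exists (f b), (f c); split; [move/f_unit|apply: IH|apply: fM].
Qed.

Section SplitsDomain.
Variable S : nzRingType.
Hypothesis dom : noncomm_domain S.
Implicit Types a b c : S.

Lemma splits_mull k b c : splits k c -> splits k (b * c).
Proof.
case: k => //= k [u [v [u_nonunit v_k ->]]]; exists (b * u), v.
by rewrite mulrA; split=> // /(domain_ring_unit_factor dom)[].
Qed.

Lemma splitsM k l a b : splits k a -> splits l b -> splits (k + l) (a * b).
Proof.
move=> a_k b_l; elim: k a a_k => [a _|k IH a]; first exact: splits_mull.
move=> [u [c [u_nonunit c_k ->]]]; exists u, (c * b).
by rewrite mulrA; split=> //; apply: IH.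
Qed.

Lemma splits_unit k a : ring_unit a -> splits k a -> k = 0.
Proof.
by case: k => //= k ua [b [c [b_nonunit _ abc]]]; case: b_nonunit;
  move: ua; rewrite abc => /(domain_ring_unit_factor dom)[].
Qed.

Hypothesis BF : BF_ring S.

(** Refining each of the k nonunits into at least one atom turns a splitting into
    a factorization with at least k atoms; a unit cofactor is absorbed into the
    last nonunit before refining.  Hence bounds on factorizations into atoms
    bound splittings. *)
Lemma splits_atoms k a : a != 0 -> ~ ring_unit a -> splits k a ->
  exists us : seq S,
    [/\ {in us, forall u, atom u}, a = \prod_(u <- us) u & (k <= size us)%N].
Proof.
have atoms_of b : b != 0 -> ~ ring_unit b -> exists us : seq S,
    [/\ {in us, forall u, atom u}, b = \prod_(u <- us) u & (0 < size us)%N].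
  move=> b0 b_nonunit.
  have [us [atoms b_us]] := BF.1 b (domain_cancellative dom b0) b_nonunit.
  exists us; split=> //; case: us b_us {atoms} => // b1.
  by case: b_nonunit; rewrite b1 big_nil; exact: ring_unit1.
elim: k a => [|k IH] a a0 a_nonunit.
  by have [us [? ? _]] := atoms_of a a0 a_nonunit; exists us.
move=> /= [b [c [b_nonunit c_k abc]]].
have [uc|c_nonunit] := pselect (ring_unit c).
  by rewrite (splits_unit uc c_k); apply: atoms_of.
have b0 : b != 0 by apply: contraNneq a0; rewrite abc => ->; rewrite mul0r.
have c0 : c != 0 by apply: contraNneq a0; rewrite abc => ->; rewrite mulr0.
have [us [atoms_us b_us us_gt0]] := atoms_of b b0 b_nonunit.
have [vs [atoms_vs c_vs le_k]] := IH c c0 c_nonunit c_k.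
exists (us ++ vs); rewrite big_cat -b_us -c_vs; split=> //.
  exact: cat_atoms.
by rewrite size_cat; lia.
Qed.

Lemma splits_bounded a : a != 0 -> exists n, forall k, splits k a -> (k <= n)%N.
Proof.
move=> a0; have [ua|a_nonunit] := pselect (ring_unit a).
  by exists 0%N => k /(splits_unit ua) ->.
have [n le_n] := BF.2 a (domain_cancellative dom a0).
exists n => k /(splits_atoms a0 a_nonunit)[us [atoms a_us le_k]].
exact: leq_trans le_k (le_n us atoms a_us).
Qed.

Definition is_splitting_length (lam : S -> nat) :=
  forall a, a != 0 ->
    splits (lam a) a /\ (forall k, splits k a -> (k <= lam a)%N).

Lemma splitting_length_exists : exists lam, is_splitting_length lam.
Proof.
pose P (a : S) n := a != 0 ->
  splits n a /\ (forall k, splits k a -> (k <= n)%N).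
suff /boolp.choice[lam lamP] : forall a, exists n, P a n by exists lam.
move=> a; rewrite /P.
have [->|a0] := eqVneq a 0; first by exists 0%N.
have [n le_n] := splits_bounded a0.
have ex : exists k, `[< splits k a >] by exists 0%N; apply/asboolP.
have ub k : `[< splits k a >] -> (k <= n)%N by move/asboolP/le_n.
case: (ex_maxnP ex ub) => m /asboolP a_m max_m.
by exists m => _; split=> // k /asboolP/max_m.
Qed.

Variable lam : S -> nat.
Hypothesis lamP : is_splitting_length lam.

Lemma splitting_lengthM a b : a != 0 -> b != 0 ->
  (lam a + lam b <= lam (a * b))%N.
Proof.
move=> a0 b0; apply: (lamP (domain_mul_neq0 dom a0 b0)).2.
by apply: splitsM; [apply: (lamP a0).1|apply: (lamP b0).1].
Qed.

Lemma splitting_length_eq0 a : a != 0 -> lam a = 0%N -> ring_unit a.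
Proof.
move=> a0 lam0; apply: contrapT => a_nonunit.
suff : (1 <= lam a)%N by rewrite lam0.
by apply: (lamP a0).2; exists a, 1; rewrite mulr1.
Qed.

Lemma splitting_length_morph (f : S -> S) a :
  {morph f : b c / b * c} -> (forall b, ring_unit (f b) -> ring_unit b) ->
  f a != 0 -> a != 0 -> (lam a <= lam (f a))%N.
Proof.
move=> fM f_unit fa0 a0; apply: (lamP fa0).2.
exact: splits_morph (lamP a0).1.
Qed.

End SplitsDomain.

(** * Leading and constant coefficients of skew products *)

Section SkewProduct.
Variables (S : nzRingType) (sigma : {rmorphism S -> S}).
Variable delta : {additive S -> S}.
Implicit Types p q : {poly S}.
Local Notation mulX := (skew_mulX sigma delta).
Local Notation mul := (skew_mul sigma delta).

Lemma coef_skew_mulX p i :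
  (mulX p)`_i = (if i is j.+1 then sigma p`_j else 0) + delta p`_i.
Proof.
rewrite coefD coefXM !coef_map_id0 ?raddf0 //.
by case: i => //= i; rewrite coef_map_id0 ?raddf0.
Qed.

Lemma skew_mulX_top n p : (size p <= n.+1)%N ->
  (size (mulX p) <= n.+2)%N /\ (mulX p)`_n.+1 = sigma p`_n.
Proof.
move=> le_p; split; last first.
  by rewrite coef_skew_mulX (nth_default _ le_p) raddf0 addr0.
apply/leq_sizeP => -[//|i] le_i.
have le_pi : (size p <= i)%N by apply: leq_trans le_p _.
by rewrite coef_skew_mulX !nth_default ?raddf0 ?addr0 // ltnW.
Qed.

Lemma iter_skew_mulX_top j n p : (size p <= n.+1)%N ->
  (size (iter j mulX p) <= (n + j).+1)%N /\
  (iter j mulX p)`_(n + j) = iter j sigma p`_n.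
Proof.
move=> le_p; elim: j => [|j [le_j top_j]]; first by rewrite addn0.
by have [? ?] := skew_mulX_top le_j; rewrite addnS /= -top_j.
Qed.

(** Stated for degree bounds rather than degrees: in this form it holds without
    any assumption on sigma or S, and both sides may vanish. *)
Lemma skew_mul_top n m p q : (size p <= n.+1)%N -> (size q <= m.+1)%N ->
  (size (mul p q) <= (n + m).+1)%N /\
  (mul p q)`_(n + m) = iter m sigma p`_n * q`_m.
Proof.
move=> le_p le_q; rewrite (skew_mulE _ _ _ le_q); split.
  apply/leq_sizeP => i lt_i; rewrite coef_sum big1 // => j _.
  have [le_j _] := iter_skew_mulX_top j le_p.
  rewrite coefMC (nth_default _ (leq_trans le_j _)) ?mul0r //.
  by apply: leq_trans lt_i; rewrite ltnS leq_add2l -ltnS.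
rewrite big_ord_recr coefD coefMC /= (iter_skew_mulX_top m le_p).2.
rewrite coef_sum big1 ?add0r // => j _.
have [le_j _] := iter_skew_mulX_top j le_p.
rewrite coefMC (nth_default _ (leq_trans le_j _)) ?mul0r //.
by rewrite -addnS leq_add2l.
Qed.

Lemma skew_mul_coef0 p q : (forall a, delta a = 0) ->
  (mul p q)`_0 = p`_0 * q`_0.
Proof.
move=> delta0; rewrite (@skew_mulE _ _ _ (size q).+1) // big_ord_recl.
rewrite coefD coefMC coef_sum big1 ?addr0 // => j _.
by rewrite coefMC /= coef_skew_mulX delta0 addr0 mul0r.
Qed.

End SkewProduct.

(** * The weight of a skew polynomial *)

Section PolyWeight.
Variables (S : nzRingType) (lam : S -> nat).
Hypothesis dom : noncomm_domain S.
Hypothesis lamP : is_splitting_length lam.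
Implicit Types p q : {poly S}.

Definition poly_weight p := ((size p).-1 + lam (lead_coef p))%N.

Lemma poly_weight_eq0 p : p != 0 -> poly_weight p = 0%N ->
  exists2 c, ring_unit c & p = c%:P.
Proof.
move=> p0 /eqP; rewrite addn_eq0 => /andP[/eqP deg0 /eqP lam0].
have /size_poly1P[c c0 p_c] : size p == 1%N.
  by rewrite -[size p]prednK ?deg0 // size_poly_gt0.
exists c => //; apply: (splitting_length_eq0 lamP c0).
by rewrite -lam0 p_c lead_coefC.
Qed.

Lemma poly_weight_map (f : S -> S) p : injective f -> f 0 = 0 ->
  {morph f : b c / b * c} -> (forall b, ring_unit (f b) -> ring_unit b) ->
  p != 0 -> (poly_weight p <= poly_weight (map_poly f p))%N.
Proof.
move=> f_inj f0 fM f_unit p0.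
have lc0 : lead_coef p != 0 by rewrite lead_coef_eq0.
rewrite /poly_weight size_map_inj_poly // lead_coef_map_inj // leq_add2l.
by apply: (splitting_length_morph lamP) => //; rewrite -f0 (inj_eq f_inj).
Qed.

Variables (sigma : {rmorphism S -> S}) (delta : {additive S -> S}).
Hypothesis sigma_inj : injective sigma.
Hypothesis sigma_unit : forall a : S, ring_unit (sigma a) -> ring_unit a.
Local Notation mul := (skew_mul sigma delta).

Lemma iter_sigma_unit n a : ring_unit (iter n sigma a) -> ring_unit a.
Proof. by elim: n => //= n IH /sigma_unit/IH. Qed.

Lemma iter_sigmaM n : {morph iter n sigma : a b / a * b}.
Proof. by move=> a b; elim: n => //= n ->; rewrite rmorphM. Qed.

Lemma iter_sigma_inj n : injective (iter n sigma).
Proof. by elim: n => //= n IH a b /sigma_inj/IH. Qed.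

Lemma iter_sigma0 n : iter n sigma 0 = 0.
Proof. by elim: n => //= n ->; rewrite rmorph0. Qed.

Lemma iter_sigma1 n : iter n sigma 1 = 1.
Proof. by elim: n => //= n ->; rewrite rmorph1. Qed.

Lemma poly_weight_skew_mul p q : p != 0 -> q != 0 ->
  mul p q != 0 /\ (poly_weight p + poly_weight q <= poly_weight (mul p q))%N.
Proof.
move=> p0 q0; set n := (size p).-1; set m := (size q).-1.
have size_p : size p = n.+1 by rewrite prednK // size_poly_gt0.
have size_q : size q = m.+1 by rewrite prednK // size_poly_gt0.
have lp0 : p`_n != 0 by rewrite -lead_coefE lead_coef_eq0.
have lq0 : q`_m != 0 by rewrite -lead_coefE lead_coef_eq0.
have slp0 : iter m sigma p`_n != 0 by rewrite -[X in _ != X](iter_sigma0 m) (inj_eq (@iter_sigma_inj m)).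
have [le_pq top_pq] : (size (mul p q) <= (n + m).+1)%N /\
    (mul p q)`_(n + m) = iter m sigma p`_n * q`_m.
  by apply: skew_mul_top; rewrite ?size_p ?size_q.
have top0 : (mul p q)`_(n + m) != 0 by rewrite top_pq domain_mul_neq0.
have size_pq : size (mul p q) = (n + m).+1.
  by apply/eqP; rewrite eqn_leq le_pq ltnNge; apply: contraNN top0 => /leq_sizeP ->.
split; first by rewrite -size_poly_gt0 size_pq.
rewrite /poly_weight !lead_coefE size_pq /= -/n -/m top_pq.
have := splitting_lengthM dom lamP slp0 lq0.
have := splitting_length_morph lamP (@iter_sigmaM m) (@iter_sigma_unit m) slp0 lp0.
move=> le_lam le_mul; rewrite addnACA leq_add2l.
by apply: leq_trans le_mul; rewrite leq_add2r.
Qed.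

End PolyWeight.

(** * Evaluating coefficient sequences at x *)

Section SkewEval.
Variables (S R : nzRingType) (iota : {rmorphism S -> R}) (x : R).
Implicit Types p q : {poly S}.

Definition skew_eval p : R := \sum_(i < size p) x ^+ i * iota p`_i.

Lemma skew_evalE n p : (size p <= n)%N ->
  skew_eval p = \sum_(i < n) x ^+ i * iota p`_i.
Proof.
move=> le_p; rewrite /skew_eval (big_ord_widen _ (fun i => x ^+ i * iota p`_i) le_p).
rewrite [RHS](bigID (fun i : 'I_n => (i < size p)%N)) /=.
rewrite [X in _ + X]big1 ?addr0 // => i; rewrite -leqNgt => le_i.
by rewrite nth_default // rmorph0 mulr0.
Qed.

Lemma skew_eval_is_additive : zmod_morphism skew_eval.
Proof.
move=> p q; pose n := maxn (size p) (size q).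
have le_pq : (size (p - q)%R <= n)%N.
  by apply: leq_trans (size_polyD _ _) _; rewrite size_polyN.
rewrite !(@skew_evalE n) ?leq_maxl ?leq_maxr // -sumrB.
by apply: eq_bigr => i _; rewrite coefB rmorphB mulrBr.
Qed.

HB.instance Definition _ :=
  GRing.isZmodMorphism.Build {poly S} R skew_eval skew_eval_is_additive.

Lemma skew_evalXM p : skew_eval ('X * p) = x * skew_eval p.
Proof.
rewrite (@skew_evalE (size p).+1); last first.
  by apply/leq_sizeP => -[//|i] le_i; rewrite coefXM nth_default.
rewrite big_ord_recl coefXM rmorph0 mulr0 add0r mulr_sumr.
by apply: eq_bigr => i _; rewrite coefXM /= exprS mulrA.
Qed.

Lemma skew_evalXnM n p : skew_eval ('X^n * p) = x ^+ n * skew_eval p.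
Proof.
elim: n => [|n IH]; first by rewrite !expr0 !mul1r.
by rewrite !exprS -!mulrA skew_evalXM IH.
Qed.

(** The commutation rule alone makes evaluation multiplicative from the skew
    product on coefficient sequences to R.  It thus applies both to skew
    polynomial rings, where evaluation is bijective, and to skew Laurent rings,
    where it is the embedding of the polynomial part. *)
Lemma skew_evalMC p b : skew_eval (p * b%:P) = skew_eval p * iota b.
Proof.
rewrite (@skew_evalE (size p)); last first.
  by apply/leq_sizeP => i le_i; rewrite coefMC nth_default // mul0r.
by rewrite mulr_suml; apply: eq_bigr => i _; rewrite coefMC rmorphM mulrA.
Qed.

Lemma skew_evalC b : skew_eval b%:P = iota b.
Proof.
rewrite (@skew_evalE 1) ?size_polyC ?leq_b1 // big_ord1.
by rewrite expr0 mul1r coefC.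
Qed.

Lemma skew_eval_map (f : S -> S) p : f 0 = 0 ->
  skew_eval (map_poly f p) = \sum_(i < size p) x ^+ i * iota (f p`_i).
Proof.
move=> f0; rewrite (@skew_evalE (size p)) ?size_poly //.
by apply: eq_bigr => i _; rewrite coef_map_id0.
Qed.

Variables (sigma : {rmorphism S -> S}) (delta : {additive S -> S}).
Hypothesis comm : forall a, iota a * x = x * iota (sigma a) + iota (delta a).

Lemma skew_eval_mulX p :
  skew_eval (skew_mulX sigma delta p) = skew_eval p * x.
Proof.
rewrite /skew_mulX raddfD /= skew_evalXM !skew_eval_map ?raddf0 //.
rewrite mulr_sumr mulr_suml -big_split; apply: eq_bigr => i _ /=.
by rewrite -mulrA comm mulrDr !mulrA -exprS -exprSr.
Qed.

(** The commutation rule alone makes evaluation multiplicative from the skew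
    product on coefficient sequences to R.  It thus applies both to skew
    polynomial rings, where evaluation is bijective, and to skew Laurent rings,
    where it is the embedding of the polynomial part. *)
Lemma skew_evalM p q :
  skew_eval (skew_mul sigma delta p q) = skew_eval p * skew_eval q.
Proof.
rewrite /skew_mul raddf_sum mulr_sumr; apply: eq_bigr => j _ /=.
rewrite skew_evalMC mulrA; congr (_ * _).
elim: (j : nat) => [|i IH]; first by rewrite mulr1.
by rewrite iterS skew_eval_mulX IH exprSr mulrA.
Qed.

End SkewEval.

(** * Skew polynomial rings *)

Section SkewPolynomials.
Variables (S : nzRingType) (sigma : {rmorphism S -> S}).
Variables (delta : {additive S -> S}).
Variables (R : nzRingType) (iota : {rmorphism S -> R}) (x : R).
Hypothesis sigma_inj : injective sigma.
Hypothesis sigma_unit : forall a : S, ring_unit (sigma a) -> ring_unit a.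
Hypothesis RP : is_skew_poly_ring sigma delta iota x.
Hypothesis BF : BF_domain S.

Local Notation eval := (skew_eval iota x).

Lemma skew_poly_eval_inj : injective eval.
Proof.
move=> p q eq_pq; have [t [_ uniq_t]] := skew_poly_expansion RP (eval p).
by rewrite -(uniq_t p erefl) -(uniq_t q eq_pq).
Qed.

Theorem skew_poly_BF_domain : BF_domain R.
Proof.
have [dom BFR] := BF; have [lam lamP] := splitting_length_exists dom BFR.
pose w r n := exists p, [/\ p != 0, r = eval p & n = poly_weight lam p].
apply: (@BF_domain_of_weight R w).
- move=> r r0; have [p [r_p _]] := skew_poly_expansion RP r.
  exists (poly_weight lam p), p; split=> //.
  by apply: contraNneq r0 => p0; rewrite r_p p0 size_poly0 big_ord0.
- move=> r _ [p [p0 -> _]]; rewrite -(raddf0 eval).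
  by rewrite (inj_eq skew_poly_eval_inj).
- by move=> r _ _ [p [_ -> ->]] [q [_ /skew_poly_eval_inj <- ->]].
- move=> r s _ _ [p [p0 -> ->]] [q [q0 -> ->]].
  have [pq0 le_pq] := poly_weight_skew_mul dom lamP delta sigma_inj sigma_unit p0 q0.
  exists (poly_weight lam (skew_mul sigma delta p q)) => //.
  exists (skew_mul sigma delta p q); split=> //.
  by rewrite (skew_evalM (skew_poly_comm RP)).
move=> r [p [p0 -> /esym/(poly_weight_eq0 lamP p0)[c [d [cd dc]] ->]]].
by rewrite skew_evalC; exists (iota d); rewrite -!rmorphM cd dc rmorph1.
Qed.

End SkewPolynomials.

(** * Skew Laurent polynomial rings *)

Lemma poly_X_adic (S : nzRingType) (p : {poly S}) : p != 0 ->
  exists j q, p = 'X^j * q /\ q`_0 != 0.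
Proof.
have [n] := ubnP (size p); elim: n p => // n IH p lt_n p0.
have [c0|c0] := eqVneq p`_0 0; last by exists 0%N, p; rewrite expr0 mul1r.
have p_X : p = 'X * drop_poly 1 p.
  apply/polyP => i; rewrite coefXM coef_drop_poly.
  by case: i => // i; rewrite /= addn1.
have d0 : drop_poly 1 p != 0.
  by apply: contraNneq p0 => d0; rewrite p_X d0 mulr0.
have [|j [q [d_q q0]]] := IH _ _ d0.
  by rewrite size_drop_poly; move: p0; rewrite -size_poly_gt0; lia.
by exists j.+1, q; rewrite {1}p_X d_q exprS mulrA.
Qed.

Lemma poly_X_adic_uniq (S : nzRingType) (p q : {poly S}) i j :
  p`_0 != 0 -> q`_0 != 0 -> 'X^i * p = 'X^j * q -> p = q.
Proof.
wlog le_ij : p q i j / (i <= j)%N => [wl|] p0 q0 eq_pq.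
  have [/wl|/ltnW/wl wl'] := leqP i j; first exact.
  by apply/esym/(wl' q p).
have eq_q : p = 'X^(j - i) * q.
  apply/polyP => k; have /(congr1 (fun t : {poly S} => t`_(k + i))) := eq_pq.
  rewrite !coefXnM addnK ltnNge leq_addl /=.
  by move=> ->; rewrite ltn_subRL [(i + k)%N]addnC subnBA.
case: (posnP (j - i)) eq_q => [->|gt0 eq_q]; first by rewrite expr0 mul1r.
by move: p0; rewrite eq_q coefXnM gt0 eqxx.
Qed.

Section SkewLaurent.
Variables (S : nzRingType) (sigma : {rmorphism S -> S}).
Variables (R : nzRingType) (iota : {rmorphism S -> R}) (x y : R).
Hypothesis sigma_bij : bijective sigma.
Hypothesis RP : is_skew_Laurent_ring sigma iota x y.
Hypothesis BF : BF_domain S.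

Local Notation eval := (skew_eval iota x).

Let xy1 : x * y = 1 := skew_Laurent_xy RP.
Let yx1 : y * x = 1 := skew_Laurent_yx RP.

Let x_unit n : ring_unit (x ^+ n).
Proof. by apply: ring_unitX; exists y. Qed.

Let xI n : GRing.lreg (x ^+ n).
Proof.
have [z [_ zx]] := x_unit n => a b eq_ab.
by rewrite -[a]mul1r -zx -mulrA eq_ab mulrA zx mul1r.
Qed.

Lemma laurent_monomialB k : zmod_morphism (fun a => zexp x y k * iota a).
Proof. by move=> a b; rewrite rmorphB mulrBr. Qed.

Definition laurent_eval : {malg S[int]} -> R :=
  malg_lift (fun k a => zexp x y k * iota a).

HB.instance Definition _ :=
  GRing.isZmodMorphism.Build {malg S[int]} R laurent_eval
    (malg_liftB laurent_monomialB).

(** A polynomial is a Laurent expansion supported in nonnegative exponents, so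
    uniqueness of Laurent expansions of 0 gives injectivity. *)
Lemma skew_Laurent_eval_inj : injective eval.
Proof.
apply: raddf_inj => p eval0.
pose c : {malg S[int]} := \sum_(i < size p) << p`_i *g (i : nat)%:Z >>.
have coef_c (i : nat) : (i < size p)%N -> c@_(Posz i) = p`_i.
  move=> lt_i; rewrite /c raddf_sum (bigD1 (Ordinal lt_i)) //=.
  rewrite mcoeffUU big1 ?addr0 // => j ne_ji; rewrite mcoeffU.
  by case: eqP => // -[eq_ij]; case/eqP: ne_ji; apply: val_inj.
have laurent_c : laurent_eval c = eval p.
  rewrite /c raddf_sum; apply: eq_bigr => i _.
  exact: (malg_liftU laurent_monomialB).
have [t [_ uniq_t]] := skew_Laurent_expansion RP 0.
have c0 : c = 0.
  have <- : t = c by apply: uniq_t; apply: etrans (esym eval0) (esym laurent_c).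
  by apply: uniq_t; rewrite msupp0 big_seq_fset0.
apply/polyP => i; rewrite coef0; have [lt_i|le_i] := ltnP i (size p).
  by rewrite -coef_c // c0 mcoeff0.
by rewrite nth_default.
Qed.

Lemma skew_Laurent_denominator r : exists n p, x ^+ n * r = eval p.
Proof.
have [c [-> _]] := skew_Laurent_expansion RP r.
apply: (big_ind (fun r => exists n p, x ^+ n * r = eval p)).
- by exists 0%N, 0; rewrite raddf0 mulr0.
- move=> r1 r2 [n1 [p1 e1]] [n2 [p2 e2]]; exists (n1 + n2)%N.
  exists ('X^n2 * p1 + 'X^n1 * p2).
  rewrite raddfD /= !skew_evalXnM -e1 -e2 mulrDr !mulrA -!exprD.
  by rewrite [(n2 + n1)%N]addnC.
move=> [n|n] _.
  by exists 0%N, ('X^n * (c@_(Posz n))%:P); rewrite skew_evalXnM skew_evalC mul1r.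
exists n.+1, (c@_(Negz n))%:P; rewrite skew_evalC mulrA /=.
suff -> : x ^+ n.+1 * y ^+ n.+1 = 1 by rewrite mul1r.
elim: n.+1 => [|m IH]; first by rewrite mulr1.
by rewrite exprSr exprS mulrA -(mulrA _ x) xy1 mulr1.
Qed.

(** Two natural exponents, one on each side, stand for an integer power of x. *)
Lemma skew_Laurent_normal r : r != 0 ->
  exists (p : {poly S}) i j, p`_0 != 0 /\ x ^+ i * r = x ^+ j * eval p.
Proof.
move=> r0; have [i [p r_p]] := skew_Laurent_denominator r.
have p0 : p != 0.
  apply: contraNneq r0 => p0; apply/eqP/(@xI i).
  by rewrite r_p p0 raddf0 mulr0.
have [j [q [p_q q0]]] := poly_X_adic p0.
by exists q, i, j; rewrite r_p p_q skew_evalXnM.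
Qed.

Lemma iota_mulXn a n : iota a * x ^+ n = x ^+ n * iota (iter n sigma a).
Proof.
elim: n => [|n IH]; first by rewrite mulr1 mul1r.
by rewrite exprSr mulrA IH -mulrA (skew_Laurent_comm RP) mulrA.
Qed.

Lemma skew_Laurent_eval_mulXn p n :
  eval p * x ^+ n = x ^+ n * eval (map_poly (iter n sigma) p).
Proof.
rewrite skew_eval_map ?iter_sigma0 // mulr_suml mulr_sumr.
by apply: eq_bigr => i _; rewrite -mulrA iota_mulXn !mulrA -!exprD addnC.
Qed.

Theorem skew_Laurent_BF_domain : BF_domain R.
Proof.
have [dom BFR] := BF; have [lam lamP] := splitting_length_exists dom BFR.
have [tau sigmaK tauK] := sigma_bij.
have sigma_inj : injective sigma := can_inj sigmaK.
have tauM : {morph tau : a b / a * b}.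
  by move=> a b; apply: sigma_inj; rewrite rmorphM !tauK.
have tau1 : tau 1 = 1 by apply: sigma_inj; rewrite rmorph1 tauK.
have sigma_unit a : ring_unit (sigma a) -> ring_unit a.
  exact: ring_unit_cancel sigmaK tauM tau1.
pose w r n := exists (p : {poly S}) i j,
  [/\ p`_0 != 0, x ^+ i * r = x ^+ j * eval p & n = poly_weight lam p].
have poly0 (p : {poly S}) : p`_0 != 0 -> p != 0.
  by apply: contraNneq => ->; rewrite coef0.
apply: (@BF_domain_of_weight R w).
- move=> r /skew_Laurent_normal[p [i [j [p0 r_p]]]].
  by exists (poly_weight lam p), p, i, j.
- move=> r _ [p [i [j [p0 r_p _]]]]; apply: contraNneq (poly0 p p0) => r0.
  apply/eqP/skew_Laurent_eval_inj; apply: (@xI j).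
  by rewrite -r_p r0 raddf0 !mulr0.
- move=> r _ _ [p [i [j [p0 r_p ->]]]] [q [k [l [q0 r_q ->]]]].
  (* Both sides evaluate to x^(i+k) r. *)
  congr poly_weight; apply: (@poly_X_adic_uniq _ p q (k + j) (i + l)) => //.
  apply: skew_Laurent_eval_inj; rewrite !skew_evalXnM !exprD -!mulrA.
  by rewrite -r_p -r_q !mulrA -!exprD addnC.
- move=> r s _ _ [p [i [j [p0 r_p ->]]]] [q [k [l [q0 s_q ->]]]].
  (* In r s = x^-i x^j p(x) x^-k x^l q(x), moving x^-k and x^l to the left of
     p(x) turns p into p1 and then into p2. *)
  pose p1 := map_poly (iter k tau) p; pose p2 := map_poly (iter l sigma) p1.
  have iter_tauK : cancel (iter k tau) (iter k sigma).
    by elim: (k) => // n IH a; rewrite [iter _ tau _]iterSr iterS IH tauK.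
  have iter_tau0 : iter k tau 0 = 0.
    by apply: (@iter_sigma_inj _ _ sigma_inj k); rewrite iter_tauK iter_sigma0.
  have p1_p : map_poly (iter k sigma) p1 = p.
    by apply/polyP => n; rewrite !coef_map_id0 ?iter_sigma0 ?iter_tauK.
  have p1_0 : p1 != 0.
    by apply: contraNneq (poly0 p p0) => p1_0; rewrite -p1_p p1_0 map_poly0.
  have le_p1 : (poly_weight lam p <= poly_weight lam p1)%N.
    apply: (poly_weight_map lamP) (poly0 p p0) => //.
    + exact: can_inj iter_tauK.
    + by move=> a b; apply: (@iter_sigma_inj _ _ sigma_inj k); rewrite iter_sigmaM !iter_tauK.
    + move=> b; apply: ring_unit_cancel iter_tauK _ _; first exact: iter_sigmaM.
      exact: iter_sigma1.
  have le_p2 : (poly_weight lam p1 <= poly_weight lam p2)%N.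
    apply: (poly_weight_map lamP) p1_0 => //.
    + exact: iter_sigma_inj.
    + exact: iter_sigma0.
    + exact: iter_sigmaM.
    + exact: iter_sigma_unit.
  have p2_0 : p2`_0 != 0.
    rewrite /p2 coef_map_id0 ?iter_sigma0 // /p1 coef_map_id0 //.
    rewrite -[X in _ != X](iter_sigma0 sigma l) (inj_eq (@iter_sigma_inj _ _ sigma_inj l)).
    by rewrite -[X in _ != X]iter_tau0 (inj_eq (can_inj iter_tauK)).
  pose null : {additive S -> S} := \0.
  pose t := skew_mul sigma null p2 q.
  have [_ le_t] :=
    poly_weight_skew_mul dom lamP null sigma_inj sigma_unit (poly0 _ p2_0) (poly0 _ q0).
  exists (poly_weight lam t); last first.
    apply: leq_trans le_t; rewrite leq_add2r.
    exact: leq_trans le_p1 le_p2.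
  exists t, (k + i)%N, (j + l)%N; split=> //.
    by rewrite skew_mul_coef0 // domain_mul_neq0.
  have comm a : iota a * x = x * iota (sigma a) + iota (null a).
    by rewrite (skew_Laurent_comm RP) /null /= rmorph0 addr0.
  have step : x ^+ (k + i) * r = x ^+ j * eval p1 * x ^+ k.
    rewrite exprD -mulrA r_p mulrA -exprD addnC exprD -!mulrA.
    by rewrite skew_Laurent_eval_mulXn p1_p.
  rewrite mulrA step -mulrA s_q (mulrA (_ * _)) -(mulrA (x ^+ j)).
  by rewrite skew_Laurent_eval_mulXn (skew_evalM comm) exprD !mulrA.
move=> r [p [i [j [p0 r_p]]]] /esym/(poly_weight_eq0 lamP (poly0 p p0))[c [d [cd dc]] p_c].
apply: (@ring_unitMl _ (x ^+ i)) => //; rewrite r_p p_c skew_evalC.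
apply: ring_unitM => //.
by exists (iota d); rewrite -!rmorphM cd dc rmorph1.
Qed.

End SkewLaurent.

Theorem proposition3p5 (S : nzRingType) (hS : BF_domain S) :
  (forall (sigma : {rmorphism S -> S}) (delta : {additive S -> S})
          (R : nzRingType) (iota : {rmorphism S -> R}) (x : R),
     injective sigma ->
     (forall a : S, ring_unit (sigma a) -> ring_unit a) ->
     sigma_derivation sigma delta ->
     is_skew_poly_ring sigma delta iota x ->
     BF_domain R) /\
  (forall (sigma : {rmorphism S -> S})
          (R : nzRingType) (iota : {rmorphism S -> R}) (x y : R),
     bijective sigma ->
     is_skew_Laurent_ring sigma iota x y ->
     BF_domain R).
Proof.
split=> [sigma delta R iota x sigma_inj sigma_unit _ RP|
         sigma R iota x y sigma_bij RP].
  exact: skew_poly_BF_domain sigma_inj sigma_unit RP hS.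
exact: skew_Laurent_BF_domain sigma_bij RP hS.
Qed.
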